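(* Let $X$ be a nonempty set, $Y$ a vector space, $L:X\to Y$ a mapping, and let $f:X\to(-\infty,+\infty]$, $g:Y\to(-\infty,+\infty]$ be such that $\operatorname{dom} g\cap L(\operatorname{dom} f)\neq\emptyset$. Let $\Phi$ be a set of functions $X\to\mathbb{R}$ and $\Psi$ a set of functions $Y\to\mathbb{R}$ with $0\in\Phi$ and $0\in\Psi$. Consider the following conditions. (i) For every $\varepsilon>0$ there exist $x_\varepsilon\in X$, $\phi_\varepsilon\in\partial_{\varepsilon,\Phi}f(x_\varepsilon)$ and $\psi_\varepsilon\in\partial_{\varepsilon,\Psi}g(Lx_\varepsilon)$ such that $$\phi_\varepsilon(z)+\psi_\varepsilon(Lz)\ge-\varepsilon\quad\text{for all } z\in X,\qquad\text{and}\qquad \phi_\varepsilon(x_\varepsilon)+\psi_\varepsilon(Lx_\varepsilon)\le\varepsilon .$$ (ii) $-\mathrm{val}(CP)=(f+g\circ L)^*_\Phi(0)=\inf_{\psi\in\Psi}\{(f+\psi\circ L)^*_\Phi(0)+g^*_\Psi(\psi)\}=-\mathrm{val}(DCP)<+\infty$. Then (i) implies (ii). If, moreover, for every $\varepsilon>0$ there exists $\psi_\varepsilon\in\Psi$ such that $$(f+\psi_\varepsilon\circ L)^*_\Phi(0)+g^*_\Psi(\psi_\varepsilon)-\varepsilon/2<\inf_{\psi\in\Psi}\{(f+\psi\circ L)^*_\Phi(0)+g^*_\Psi(\psi)\}$$ and $-\psi_\varepsilon\circ L\in\Phi$, then (i) and (ii) are equivalent.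
   Context: For $h:X\to(-\infty,+\infty]$, $\operatorname{dom}h=\{x: h(x)<+\infty\}$. For a set $\Phi$ of functions $X\to\mathbb{R}$ and $\phi\in\Phi$, the $\Phi$-conjugate is $h^*_\Phi(\phi)=\sup_{x\in X}\{\phi(x)-h(x)\}$. For $\varepsilon\ge0$ and $x\in\operatorname{dom}h$, $\partial_{\varepsilon,\Phi}h(x)=\{\phi\in\Phi: h(y)-h(x)\ge\phi(y)-\phi(x)-\varepsilon\ \ \forall y\in X\}$ (an element of $\partial_{\varepsilon,\Phi}h(x)$ is only considered at points $x\in\operatorname{dom}h$). The analogous notions $g^*_\Psi$ and $\partial_{\varepsilon,\Psi}g$ are used for functions $g$ on $Y$ and the set $\Psi$. Primal value: $\mathrm{val}(CP)=\inf_{x\in X}\{f(x)+g(Lx)\}$. Conjugate dual value: $\mathrm{val}(DCP)=\sup_{\psi\in\Psi}\{-\sup_{x\in X}\{-\psi(Lx)-f(x)\}-g^*_\Psi(\psi)\}$. Note that $(f+\psi\circ L)^*_\Phi(0)=\sup_{x\in X}\{-f(x)-\psi(Lx)\}$. *)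

(* Defs.v *)
From mathcomp Require Import all_boot all_order all_algebra.
From mathcomp Require Import all_classical all_reals all_analysis.

Set Implicit Arguments.
Unset Strict Implicit.
Unset Printing Implicit Defensive.

Import Order.TTheory GRing.Theory Num.Theory.

Local Open Scope classical_set_scope.
Local Open Scope ring_scope.
Local Open Scope ereal_scope.

Definition edom (R : realType) (T : Type) (h : T -> \bar R) : set T :=
  [set x | h x < +oo].

(* The class Phi only serves as the domain of the conjugate h^*_Phi: the value
   at phi does not depend on it, so Phi is not a parameter. For h > -oo the
   difference below is never of the form oo - oo. *)
Definition conjugate (R : realType) (T : Type) (h : T -> \bar R)
    (phi : T -> R) : \bar R :=
  ereal_sup [set (phi x)%:E - h x | x in [set: T]].

(* Empty when x is not in the domain of h. *)
Definition eps_subdiff (R : realType) (T : Type) (eps : R)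
    (Phi : set (T -> R)) (h : T -> \bar R) (x : T) : set (T -> R) :=
  [set phi | [/\ Phi phi, edom h x &
    forall y, (phi y - phi x - eps)%:E <= h y - h x]].

Definition val_CP (R : realType) (X Y : Type) (L : X -> Y)
    (f : X -> \bar R) (g : Y -> \bar R) : \bar R :=
  ereal_inf [set f x + g (L x) | x in [set: X]].

Definition val_DCP (R : realType) (X Y : Type) (L : X -> Y)
    (f : X -> \bar R) (g : Y -> \bar R) (Psi : set (Y -> R)) : \bar R :=
  ereal_sup [set - ereal_sup [set - (psi (L x))%:E - f x | x in [set: X]]
                 - conjugate g psi | psi in Psi].

(* (f + psi \o L)^*_Phi (0) + g^*_Psi (psi) *)
Definition dual_obj (R : realType) (X Y : Type) (L : X -> Y)
    (f : X -> \bar R) (g : Y -> \bar R) (psi : Y -> R) : \bar R :=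
  conjugate (fun x => f x + (psi (L x))%:E) (cst 0%R) + conjugate g psi.

Definition eps_optimality (R : realType) (X Y : Type) (L : X -> Y)
    (f : X -> \bar R) (g : Y -> \bar R)
    (Phi : set (X -> R)) (Psi : set (Y -> R)) : Prop :=
  forall eps : R, (0 < eps)%R ->
  exists (x : X) (phi : X -> R) (psi : Y -> R),
    [/\ eps_subdiff eps Phi f x phi,
        eps_subdiff eps Psi g (L x) psi,
        (forall z : X, - eps <= phi z + psi (L z))%R &
        (phi x + psi (L x) <= eps)%R].

Definition zero_gap (R : realType) (X Y : Type) (L : X -> Y)
    (f : X -> \bar R) (g : Y -> \bar R) (Psi : set (Y -> R)) : Prop :=
  [/\ - val_CP L f g = conjugate (fun x => f x + g (L x)) (cst 0%R),
      conjugate (fun x => f x + g (L x)) (cst 0%R) =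
        ereal_inf [set dual_obj L f g psi | psi in Psi],
      ereal_inf [set dual_obj L f g psi | psi in Psi] = - val_DCP L f g Psi &
      - val_DCP L f g Psi < +oo].

(* Main.v *)
(* By the Fenchel-Young inequality every dual objective value is at least
   -val(CP). Under (i), adding the two eps-subgradient inequalities shows that
   psi_eps has dual objective value at most -(f x_eps + g (L x_eps)) + 4 eps,
   which closes the gap. Conversely, given a dual psi that is eps/2-optimal and
   a primal x that is eps/2-optimal, Fenchel-Young for each of the two
   conjugates shows that phi := - psi \o L and psi are eps-subgradients at x. *)
Require Import Defs.
From mathcomp Require Import all_boot all_order all_algebra.
From mathcomp Require Import all_classical all_reals all_analysis.
From mathcomp Require Import ring lra.

Set Implicit Arguments.
Unset Strict Implicit.
Unset Printing Implicit Defensive.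

Import Order.TTheory GRing.Theory Num.Theory.

Local Open Scope classical_set_scope.
Local Open Scope ring_scope.
Local Open Scope ereal_scope.

Lemma gtNy_fin (R : realType) (a : \bar R) :
  -oo < a -> a < +oo -> exists r : R, a = r%:E.
Proof. by case: a => // r _ _; exists r. Qed.

Lemma conjugate_ge (R : realType) (T : Type) (h : T -> \bar R) (phi : T -> R)
    (x : T) : (phi x)%:E - h x <= conjugate h phi.
Proof. by apply: ereal_sup_ubound; exists x. Qed.

Lemma conjugate_le (R : realType) (T : Type) (h : T -> \bar R) (phi : T -> R)
    (c : \bar R) :
  (forall x, (phi x)%:E - h x <= c) -> conjugate h phi <= c.
Proof. by move=> hc; apply: ge_ereal_sup => _ [x _ <-]. Qed.

(** A point of the domain contributes a term above [-oo] to the supremum. This rules out the form oo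
    - oo when two conjugates are added. *)
Lemma conjugate_gtNy (R : realType) (T : Type) (h : T -> \bar R)
    (phi : T -> R) : edom h !=set0 -> -oo < conjugate h phi.
Proof.
move=> [x hx]; apply: lt_le_trans (conjugate_ge h phi x).
by move: hx; rewrite /edom /=; case: (h x) => [r| |] //= _; rewrite ltNyr.
Qed.

Lemma edomD_fin (R : realType) (T : Type) (h : T -> \bar R) (u : T -> R) :
  edom h !=set0 -> edom (fun x => h x + (u x)%:E) !=set0.
Proof.
move=> [x hx]; exists x; move: hx; rewrite /edom /=.
by case: (h x) => [r| |] // _; rewrite -EFinD ltry.
Qed.

Lemma oppe_val_CP (R : realType) (X Y : Type) (L : X -> Y)
    (f : X -> \bar R) (g : Y -> \bar R) :
  - val_CP L f g = conjugate (fun x => f x + g (L x)) (cst 0%R).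
Proof.
rewrite /val_CP /ereal_inf oppeK image_comp /conjugate; congr ereal_sup.
by apply: eq_imagel => x _ /=; rewrite add0e.
Qed.

(** A mere change of sign, free of any optimality assumption: both conjugates exceed [-oo], so
    negation distributes over their sum. *)
Lemma ereal_inf_dual_obj (R : realType) (X Y : Type) (L : X -> Y)
    (f : X -> \bar R) (g : Y -> \bar R) (Psi : set (Y -> R)) :
  edom f !=set0 -> edom g !=set0 ->
  ereal_inf [set dual_obj L f g psi | psi in Psi] = - val_DCP L f g Psi.
Proof.
move=> f0 g0; rewrite /ereal_inf image_comp /val_DCP.
congr (- ereal_sup _); apply: eq_imagel => psi _ /=.
rewrite /dual_obj oppeD; last first.
  apply: ltninfty_adde_def; rewrite inE; last exact: conjugate_gtNy.
  exact/conjugate_gtNy/edomD_fin.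
congr (- _ - _); rewrite /conjugate; congr ereal_sup.
by apply: eq_imagel => x _ /=; rewrite add0e fin_num_oppeD// addeC.
Qed.

(** Bounding the two conjugates below by their terms at [x] and at [L x] makes [psi (L x)]
    cancel. *)
Lemma weak_duality (R : realType) (X Y : Type) (L : X -> Y)
    (f : X -> \bar R) (g : Y -> \bar R) (psi : Y -> R) :
  (forall x, -oo < f x) -> (forall y, -oo < g y) ->
  edom f !=set0 -> edom g !=set0 ->
  - val_CP L f g <= dual_obj L f g psi.
Proof.
move=> fN gN f0 g0; rewrite oppe_val_CP; apply: conjugate_le => x /=.
rewrite add0e.
have A := conjugate_ge (fun x => f x + (psi (L x))%:E) (cst 0%R) x.
have B := conjugate_ge g psi (L x).
apply: le_trans (leeD A B); rewrite /= add0e.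
move: (fN x) (gN (L x)).
case: (f x) => [a| |] //; case: (g (L x)) => [b| |] //= _ _.
by rewrite -!EFinD lee_fin; lra.
Qed.

(** Each of the four hypotheses on [phi] and [psi] costs one [eps]: the subgradient of [f] and the
    lower bound on [phi z + psi (L z)] enter the first conjugate, the subgradient of [g] the second,
    and the upper bound at [x] their sum. *)
Lemma eps_subdiffs_dual_obj_le (R : realType) (X Y : Type) (L : X -> Y)
    (f : X -> \bar R) (g : Y -> \bar R) (Phi : set (X -> R))
    (Psi : set (Y -> R)) (eps : R) (x : X) (phi : X -> R) (psi : Y -> R) :
  (forall x, -oo < f x) -> (forall y, -oo < g y) ->
  eps_subdiff eps Phi f x phi -> eps_subdiff eps Psi g (L x) psi ->
  (forall z, - eps <= phi z + psi (L z))%R ->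
  (phi x + psi (L x) <= eps)%R ->
  dual_obj L f g psi <= - (f x + g (L x)) + (4 * eps)%:E.
Proof.
move=> fN gN [_ fx fsub] [_ gx gsub] ge_eps le_eps.
have [a fxa] := gtNy_fin (fN x) fx; have [b gxb] := gtNy_fin (gN (L x)) gx.
have A : conjugate (fun z => f z + (psi (L z))%:E) (cst 0%R)
    <= (phi x - a + 2 * eps)%:E.
  apply: conjugate_le => z /=; move: (fsub z) (fN z) (ge_eps z).
  rewrite fxa; case: (f z) => [c| |] //=; last by rewrite leNye.
  by rewrite -!EFinD !lee_fin; lra.
have B : conjugate g psi <= (psi (L x) - b + eps)%:E.
  apply: conjugate_le => y; move: (gsub y) (gN y).
  rewrite gxb; case: (g y) => [c| |] //=; last by rewrite leNye.
  by rewrite -!EFinD !lee_fin; lra.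
apply: le_trans (leeD A B) _.
by rewrite fxa gxb -!EFinD lee_fin; lra.
Qed.

Lemma eps_optimality_zero_gap (R : realType) (X Y : Type) (L : X -> Y)
    (f : X -> \bar R) (g : Y -> \bar R) (Phi : set (X -> R))
    (Psi : set (Y -> R)) :
  (forall x, -oo < f x) -> (forall y, -oo < g y) ->
  edom f !=set0 -> edom g !=set0 ->
  eps_optimality L f g Phi Psi -> zero_gap L f g Psi.
Proof.
move=> fN gN f0 g0 opt.
have inf_le eps : (0 < eps)%R -> exists x, [/\ edom f x, edom g (L x) &
    ereal_inf [set dual_obj L f g psi | psi in Psi]
      <= - (f x + g (L x)) + (4 * eps)%:E].
  move=> /opt[x [phi [psi [fsub gsub ge_eps le_eps]]]].
  exists x; split; [by case: fsub|by case: gsub|].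
  apply: le_trans (eps_subdiffs_dual_obj_le fN gN fsub gsub ge_eps le_eps).
  by apply: ereal_inf_lbound; exists psi => //; case: gsub.
rewrite /zero_gap -ereal_inf_dual_obj// -oppe_val_CP; split=> //.
- apply/eqP; rewrite eq_le; apply/andP; split.
    by apply/ereal_infP => _ [psi _ <-]; exact: weak_duality.
  apply/lee_addgt0Pr => eps eps0.
  have [|x [_ _ /le_trans]] := inf_le (eps / 4)%R; first by rewrite divr_gt0.
  apply; have -> : (4 * (eps / 4) = eps)%R by field.
  by rewrite leeD2r// leeN2; apply: ereal_inf_lbound; exists x.
(* Any fixed tolerance bounds the infimum by a real number; 1 is an arbitrary choice. *)
- have [x [fx gx /le_lt_trans]] := inf_le 1%R ltr01; apply.
  have [a ->] := gtNy_fin (fN x) fx; have [b ->] := gtNy_fin (gN (L x)) gx.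
  by rewrite -!EFinD ltry.
Qed.

Lemma near_optimal_eps_subdiffs (R : realType) (X Y : Type) (L : X -> Y)
    (f : X -> \bar R) (g : Y -> \bar R) (Phi : set (X -> R))
    (Psi : set (Y -> R)) (eps v : R) (x : X) (psi : Y -> R) :
  (forall x, -oo < f x) -> (forall y, -oo < g y) ->
  Psi psi -> Phi (fun z => - psi (L z))%R ->
  f x + g (L x) <= (v + eps / 2)%:E ->
  dual_obj L f g psi <= (- v + eps / 2)%:E ->
  eps_subdiff eps Phi f x (fun z => - psi (L z))%R /\
  eps_subdiff eps Psi g (L x) psi.
Proof.
move=> fN gN Psipsi Phipsi primal dual.
(* A sum bounded by a real number, with both terms above [-oo], has finite terms. *)
have [[a fxa] [b gxb]] : (exists a, f x = a%:E) /\ (exists b, g (L x) = b%:E).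
  move: primal (fN x) (gN (L x)).
  by case: (f x) (g (L x)) => [a| |] [b| |] //= _ _ _; split; eexists.
(* The points [z] and [y] are independent here. Fixing [y = L x] leaves the subgradient inequality
   for [f], fixing [z = x] the one for [g]; the primal and dual slacks [eps / 2] add up to [eps]. *)
have young z y : 0 - (f z + (psi (L z))%:E) + ((psi y)%:E - g y)
    <= (- v + eps / 2)%:E.
  apply: le_trans dual; apply: leeD; last exact: conjugate_ge.
  exact: (conjugate_ge (fun z => f z + (psi (L z))%:E) (cst 0%R)).
move: primal; rewrite fxa gxb -EFinD lee_fin => primal.
split; split=> //; rewrite ?/edom /= ?fxa ?gxb ?ltry//.
- move=> z; move: (young z (L x)) (fN z); rewrite gxb.
  case: (f z) => [c| |] //=; last by rewrite leey.
  by rewrite -!EFinD !lee_fin; lra.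
- move=> y; move: (young x y) (gN y); rewrite fxa.
  case: (g y) => [c| |] //=; last by rewrite leey.
  by rewrite -!EFinD !lee_fin; lra.
Qed.

Lemma zero_gap_eps_optimality (R : realType) (X Y : Type) (L : X -> Y)
    (f : X -> \bar R) (g : Y -> \bar R) (Phi : set (X -> R))
    (Psi : set (Y -> R)) :
  (forall x, -oo < f x) -> (forall y, -oo < g y) ->
  val_CP L f g < +oo ->
  (forall eps : R, (0 < eps)%R ->
    exists psi : Y -> R,
      [/\ Psi psi,
          dual_obj L f g psi - (eps / 2)%:E
            < ereal_inf [set dual_obj L f g psi' | psi' in Psi] &
          Phi (fun x => - psi (L x))%R]) ->
  zero_gap L f g Psi -> eps_optimality L f g Phi Psi.
Proof.
move=> fN gN valy near_opt [val_eq inf_eq dcp_eq dcp_lty] eps eps0.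
have infE : ereal_inf [set dual_obj L f g psi | psi in Psi] = - val_CP L f g.
  by rewrite val_eq inf_eq.
(* The value exceeds [-oo] because its opposite equals [- val_DCP L f g Psi], which is below
   [+oo]. *)
have [v vE] : exists v, val_CP L f g = v%:E.
  apply: gtNy_fin => //; move: dcp_lty; by rewrite -dcp_eq infE lteNl.
have [psi [Psipsi]] := near_opt _ eps0.
rewrite infE vE lteBlDr// -EFinD => /ltW dual Phipsi.
have /ereal_inf_lt[_ [x _ <-] /ltW primal] : val_CP L f g < (v + eps / 2)%:E.
  by rewrite vE lte_fin; lra.
have [fsub gsub] := near_optimal_eps_subdiffs fN gN Psipsi Phipsi primal dual.
(* With this choice [phi + psi \o L] vanishes identically, so both remaining bounds compare 0 with
   [- eps] or [eps]. *)
exists x, (fun z => - psi (L z))%R, psi; split=> // [z|]; rewrite addNr//.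
  by rewrite oppr_le0 ltW.
exact: ltW.
Qed.

Theorem theorem4p3 (R : realType) (X : Type) (Y : lmodType R) (L : X -> Y)
  (f : X -> \bar R) (g : Y -> \bar R)
  (Phi : set (X -> R)) (Psi : set (Y -> R))
  (X_nonempty : inhabited X)
  (f_gtNy : forall x, -oo < f x) (g_gtNy : forall y, -oo < g y)
  (dom_meet : edom g `&` (L @` edom f) !=set0)
  (Phi0 : Phi (cst 0%R)) (Psi0 : Psi (cst 0%R)) :
  (eps_optimality L f g Phi Psi -> zero_gap L f g Psi) /\
  ((forall eps : R, (0 < eps)%R ->
      exists psi : Y -> R,
        [/\ Psi psi,
            dual_obj L f g psi - (eps / 2)%:E
              < ereal_inf [set dual_obj L f g psi' | psi' in Psi] &
            Phi (fun x => - psi (L x))%R]) ->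
   (eps_optimality L f g Phi Psi <-> zero_gap L f g Psi)).
Proof.
have [y [gy [x fx Lxy]]] := dom_meet; subst y.
have f0 : edom f !=set0 by exists x.
have g0 : edom g !=set0 by exists (L x).
(* The common domain point bounds the primal value above, which the converse uses to make that value
   real. *)
have val_lty : val_CP L f g < +oo.
  apply: (@le_lt_trans _ _ (f x + g (L x))); last exact: lte_add_pinfty.
  by apply: ereal_inf_lbound; exists x.
have gap := eps_optimality_zero_gap f_gtNy g_gtNy f0 g0.
split=> [|near_opt]; first exact: gap.
by split; [exact: gap|exact: zero_gap_eps_optimality].
Qed.
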